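(* Let $M_c$ be a melon graph with endpoints $0$ and $0'$ that is a comparability graph. If the endpoints $0$ and $0'$ are adjacent in $M_c$, then $\mathcal{R}^p(M_c)\le 3$.
   Context: All graphs are finite and simple. A melon graph $M=(E_1,\ldots,E_m)$ ($m\ge 1$) is the graph formed as the union of $m$ paths $E_1,\ldots,E_m$ (the constituent paths), all having the same two distinct endpoints $0$ and $0'$, and pairwise sharing no vertices other than $0$ and $0'$; since $M$ is simple, at most one constituent path has length one (length = number of edges). A comparability graph is a graph admitting a transitive orientation. Two letters $a\neq b$ alternate in a word $w$ if the subword of $w$ consisting of all occurrences of $a$ and $b$ is of the form $abab\cdots$ or $baba\cdots$. A word $w$ represents a graph $G=(V,E)$ if for all distinct $a,b\in V$: $\{a,b\}\in E$ if and only if $a$ and $b$ alternate in $w$. $G$ is permutationally $k$-representable if it is represented by a word $p_1p_2\cdots p_k$ where each $p_i$ is a permutation of $V$ (a word containing each vertex exactly once); such a $k$ exists exactly for comparability graphs. The permutation-representation number $\mathcal{R}^p(G)$ of a comparability graph $G$ is the smallest such $k$. *)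

(* Defs.v *)
From mathcomp Require Import all_boot.

Set Implicit Arguments.
Unset Strict Implicit.
Unset Printing Implicit Defensive.

Section Graphs.

Variable V : finType.
Implicit Types (e o : rel V) (a b x y z : V) (s w p : seq V).

Definition simple_graph e : Prop := symmetric e /\ irreflexive e.

(* Each edge gets exactly one direction, and every arc comes from an edge. *)
Definition orientation e o : Prop :=
  (forall x y, e x y = o x y || o y x) /\ (forall x y, ~~ (o x y && o y x)).

Definition comparability_graph e : Prop :=
  exists o, orientation e o /\ transitive o.

(* A path is given by the list of its vertices, endpoints included; its length *)
(* is therefore (size s).-1, and x, y span one of its edges when they are      *)
(* consecutive in the list, in either order.                                   *)
Definition path_from_to z z' s : Prop :=
  uniq s /\ exists p, s = z :: rcons p z'.

Definition path_edge s x y : bool := infix [:: x; y] s || infix [:: y; x] s.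

(* The vertex set of the melon graph is the whole of V.  Since every E i is    *)
(* duplicate-free and m > 0, the endpoints z and z' are distinct.              *)
Definition melon_graph e z z' : Prop :=
  exists (m : nat) (E : 'I_m -> seq V),
    [/\ (0 < m)%N,
        forall i, path_from_to z z' (E i),
        forall i j, i != j ->
          forall x, x \in E i -> x \in E j -> x = z \/ x = z',
        forall i j, (size (E i)).-1 = 1 -> (size (E j)).-1 = 1 -> i = j
      & (forall x, exists i, x \in E i) /\
        (forall x y, e x y <-> exists i, path_edge (E i) x y)].

(* The word a b a b ... with n letters. *)
Definition alt_word a b (n : nat) : seq V :=
  mkseq (fun i => if odd i then b else a) n.

Definition alternate w a b : Prop :=
  exists n, [seq c <- w | (c == a) || (c == b)] = alt_word a b n \/
            [seq c <- w | (c == a) || (c == b)] = alt_word b a n.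

Definition represents w e : Prop :=
  forall a b, a != b -> (e a b <-> alternate w a b).

Definition permutation_word p : Prop := forall x, count_mem x p = 1.

(* A word representing a graph must contain every vertex, so k = 0 (the empty  *)
(* word, in which all pairs would alternate vacuously) is excluded.            *)
Definition perm_representable e (k : nat) : Prop :=
  (0 < k)%N /\
  exists p : 'I_k -> seq V,
    (forall i, permutation_word (p i)) /\
    represents (flatten [seq p i | i <- enum 'I_k]) e.

(* "k is the permutation-representation number of e", as a functional relation *)
(* because the number is only defined for comparability graphs.                *)
Definition is_perm_rep_number e (k : nat) : Prop :=
  perm_representable e k /\ forall j, perm_representable e j -> (k <= j)%N.

End Graphs.

(* Main.v *)
Require Import Defs.
From mathcomp Require Import all_boot all_order zify.
From Stdlib Require Import Classical.

Set Implicit Arguments.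
Unset Strict Implicit.
Unset Printing Implicit Defensive.

Import Order.TTheory.

(** A concatenation of permutations of V represents a graph exactly when two
    letters are adjacent iff all the permutations put them in the same order
    ([alternate_flattenP]).  So three permutations suffice as soon as the edges
    are the comparable pairs of a strict order that is the intersection of three
    linear orders, a realizer of size 3 ([realizer_representable]).

    Such an order is nearly forced.  In a path of length at least 3 two vertices
    at distance 2 are not adjacent, hence a transitive orientation has to reverse
    its direction at every step of the cycle that the path closes with the edge
    z z'; this cycle is therefore even and the path has odd length
    ([path_length_odd]).  Every path other than the edge z z' thus either has
    length 2, and forms a triangle with z z', or is a fence of odd length.
    Orient all the edges as follows: z is below z', the middle vertex of a
    triangle lies between z and z', and on a fence z = v_0, v_1, ..., v_l = z' the
    vertices of even position are below their neighbours ([below]).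

    What remains is to find the realizer.  Write low and high for the two inner
    vertices v_2 and v_1 of a fence of length 3, and call a fence long if l is at
    least 5.  The inner vertices of one long fence form a poset realized by
    up = v_2 v_1 v_4 v_3 ... v_(l-1) v_(l-2) and
    down = v_(l-1) v_(l-3) v_(l-2) ... v_2 v_3 v_1.  With the paths numbered, the
    three linear orders consist of the following blocks, where inc and dec tell
    the order in which a block runs through the numbers:
    - z; up without its last two vertices, for long fences (inc);
      middle vertices (inc); low high, for short fences (dec);
      v_(l-1) v_(l-2), for long fences (dec); z';
    - down without v_1, for long fences (inc); z; low high, for short fences
      (inc); middle vertices (inc); v_1, for long fences (inc); z';
    - low, for short fences (inc); v_(l-1), for long fences (dec); z;
      middle vertices (dec); z'; high, for short fences (inc);
      down without v_(l-1), for long fences (dec).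

    The last two orders keep each long fence in the order down and run through
    the fences in opposite directions, which separates nearly all the pairs from
    distinct long fences.  Only v_1, which must stay above z, and v_(l-1), which
    must stay below z', are displaced; this lets z be above every v_j with j > 1
    in the second order, and z' below every v_j with j < l-1 in the third.  The
    first order repairs the pairs that these displacements spoil: it puts v_1
    early and v_(l-1) late.  The blocks of the short fences fill the gaps.  That
    the intersection of the three orders is the required one is checked in
    [below_keys] and [incomparable_keys]. *)

(** * The representation number is bounded by any length that works *)

Lemma perm_rep_number_le (V : finType) (e : rel V) n :
  perm_representable e n -> exists k, is_perm_rep_number e k /\ k <= n.
Proof.
elim/ltn_ind: n => n IHn rep_n.
have [[j [lt_jn rep_j]] | least_n] :=
  classic (exists j, j < n /\ perm_representable e j).
  have [k [min_k le_kj]] := IHn j lt_jn rep_j.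
  by exists k; split=> //; apply: leq_trans le_kj (ltnW lt_jn).
exists n; split=> //; split=> // j rep_j.
by rewrite leqNgt; apply/negP => lt_jn; apply: least_n; exists j.
Qed.

(** * Alternation in concatenated permutations *)

Section Words.

Variable V : finType.
Implicit Types (a b : V) (s p : seq V).

Lemma filter_pair s a b :
  uniq s -> b \in s -> index a s < index b s ->
  [seq c <- s | (c == a) || (c == b)] = [:: a; b].
Proof.
move=> uniq_s b_s lt_ab.
have a_s : a \in s by rewrite -index_mem (ltn_trans lt_ab) ?index_mem.
have filter0 t : a \notin t -> b \notin t ->
    [seq c <- t | (c == a) || (c == b)] = [::].
  move=> a't b't; apply/eqP; rewrite -(negbK (_ == _)) -has_filter.
  by apply/hasPn => c c_t; apply/norP; split; apply: contraTneq c_t => ->.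
move: uniq_s b_s lt_ab; case/splitPr: a_s => s1 s2.
rewrite cat_uniq /= negb_or => /and3P[_ /andP[a's1 _] /andP[a's2 uniq_s2]].
rewrite mem_cat index_cat (negPf a's1) /= eqxx addn0 index_cat inE.
case: ifP => [b_s1 _|b's1 /=]; first by rewrite ltnNge index_size.
have [->|ne_ba] /= := eqVneq b a; first by rewrite addn0 ltnn.
move=> b_s2 _; case/splitPr: b_s2 a's2 uniq_s2 => s3 s4.
rewrite cat_uniq /= negb_or mem_cat inE !negb_or.
case/and3P=> a's3 _ a's4 /and3P[_ /andP[b's3 _] /andP[b's4 _]].
rewrite filter_cat /= eqxx /= filter_cat /= eqxx orbT.
by rewrite !filter0 ?b's1.
Qed.

Lemma filter_permutation_word p a b :
  permutation_word p -> a != b ->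
  [seq c <- p | (c == a) || (c == b)] =
    if index a p < index b p then [:: a; b] else [:: b; a].
Proof.
move=> perm_p ne_ab.
have mem_p x : x \in p by rewrite -has_pred1 has_count perm_p.
have uniq_p : uniq p by apply: count_mem_uniq => x; rewrite perm_p mem_p.
case: ltnP => [lt_ab|]; first exact: filter_pair.
rewrite leq_eqVlt => /orP[/eqP eq_ba|lt_ba].
  by rewrite (index_inj a (mem_p b) (mem_p a) eq_ba) eqxx in ne_ab.
rewrite -(filter_pair uniq_p (mem_p a) lt_ba).
by apply: eq_filter => c; rewrite orbC.
Qed.

Lemma alt_wordSS a b n : alt_word a b n.+2 = [:: a, b & alt_word a b n].
Proof.
rewrite /alt_word /mkseq /= (iotaDl 2 0 n) -map_comp.
by congr [:: _, _ & _]; apply: eq_map => i /=; rewrite negbK.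
Qed.

(** The factor that a permutation contributes to the subword on a and b; t tells
    whether a comes first in it. *)
Definition two_letters a b (t : bool) := if t then [:: a; b] else [:: b; a].

Lemma flatten_two_letters_alt a b (ts : seq bool) :
  all id ts -> flatten (map (two_letters a b) ts) = alt_word a b (size ts).*2.
Proof.
elim: ts => //= -[] //= ts IHts all_ts.
by rewrite IHts // doubleS alt_wordSS.
Qed.

Lemma flatten_two_letters_altP a b (ts : seq bool) n :
  a != b -> flatten (map (two_letters a b) ts) = alt_word a b n -> all id ts.
Proof.
move=> ne_ab; elim: ts n => //= t ts IHts [|[|n]]; try by case: t.
rewrite alt_wordSS; case: t => /= -[]; first exact: IHts.
by move=> eq_ba; rewrite eq_ba eqxx in ne_ab.
Qed.

(** Each permutation contributes a b or b a to the subword on a and b, and two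
    consecutive factors a b and b a would repeat a letter. *)
Lemma alternate_flattenP (I : Type) (r : seq I) (p : I -> seq V) a b :
  (forall i, permutation_word (p i)) -> a != b ->
  alternate (flatten (map p r)) a b <->
    all (fun i => index a (p i) < index b (p i)) r \/
    all (fun i => index b (p i) < index a (p i)) r.
Proof.
move=> perm_p ne_ab; have half x y : x != y ->
    (exists n, [seq c <- flatten (map p r) | (c == x) || (c == y)] =
               alt_word x y n) <->
    all (fun i => index x (p i) < index y (p i)) r.
  move=> ne_xy; rewrite filter_flatten -map_comp.
  have -> : map (filter (fun c => (c == x) || (c == y)) \o p) r =
      map (two_letters x y) [seq index x (p i) < index y (p i) | i <- r].
    rewrite -map_comp; apply: eq_map => i /=.
    by rewrite filter_permutation_word.
  have -> : all (fun i => index x (p i) < index y (p i)) r =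
      all id [seq index x (p i) < index y (p i) | i <- r] by rewrite all_map.
  split=> [[n]|all_lt]; first exact: flatten_two_letters_altP.
  by eexists; apply: flatten_two_letters_alt.
have ne_ba : b != a by rewrite eq_sym.
rewrite -(half a b ne_ab) -(half b a ne_ba).
have <- : [seq c <- flatten (map p r) | (c == a) || (c == b)] =
    [seq c <- flatten (map p r) | (c == b) || (c == a)].
  by apply: eq_filter => c; rewrite orbC.
split=> [[n [alt|alt]]|[[n alt]|[n alt]]]; last by exists n; right.
- by left; exists n.
- by right; exists n.
- by exists n; left.
Qed.

End Words.

(** * Realizers *)

Section Realizer.

Variables (V : finType) (disp : Order.disp_t) (T : orderType disp).
Local Open Scope order_scope.

(** The permutations are the vertices sorted by the keys.  The keys need not be
    injective: the second hypothesis on them already makes each incomparable pair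
    occur in both orders, so that ties may be broken arbitrarily. *)
Lemma realizer_representable
    (e below : rel V) (k : nat) (key : 'I_k -> V -> T) :
  (0 < k)%N ->
  (forall x y, e x y = below x y || below y x) ->
  (forall x y, below x y -> forall i, key i x < key i y) ->
  (forall x y, x != y -> ~~ below x y -> ~~ below y x ->
     exists i, key i x < key i y) ->
  perm_representable e k.
Proof.
move=> k_gt0 eE below_lt incomparable_lt; split=> //.
pose leT i := relpre (key i) <=%O.
pose p i := sort (leT i) (enum V).
have perm_p i : permutation_word (p i).
  move=> x; rewrite count_sort.
  by rewrite count_uniq_mem ?enum_uniq // mem_enum.
have before_lt i x y : key i x < key i y -> (index x (p i) < index y (p i))%N.
  move=> lt_xy; have mem_p c : c \in p i by rewrite mem_sort mem_enum.
  rewrite ltnNge; apply: contraTN lt_xy; rewrite leq_eqVlt -leNgt.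
  case/orP=> [/eqP eq_yx|].
    by rewrite (index_inj x (mem_p y) (mem_p x) eq_yx).
  apply: (sorted_ltn_index (leT := leT i)); rewrite ?mem_p //.
    by move=> ? ? ?; apply: le_trans.
  by apply: sort_sorted => ? ?; apply: le_total.
exists p; split=> // a b ne_ab; rewrite alternate_flattenP // eE.
have all_below x y : below x y ->
    all (fun i => index x (p i) < index y (p i))%N (enum 'I_k).
  by move=> lt_xy; apply/allP => i _; apply: before_lt; apply: below_lt.
have not_all x y : x != y -> ~~ below x y -> ~~ below y x ->
    ~~ all (fun i => index y (p i) < index x (p i))%N (enum 'I_k).
  move=> ne_xy nxy nyx; have [i lt_xy] := incomparable_lt x y ne_xy nxy nyx.
  apply/allPn; exists i; first by rewrite mem_enum.
  by rewrite -leqNgt ltnW ?before_lt.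
split=> [/orP[lt_ab|lt_ba]|all_lt]; first by left; apply: all_below.
  by right; apply: all_below.
apply: contraT => /norP[nab nba].
have ne_ba : b != a by rewrite eq_sym.
case: all_lt; first by rewrite (negPf (not_all b a ne_ba nba nab)).
by rewrite (negPf (not_all a b ne_ab nab nba)).
Qed.

End Realizer.

(** * Induced cycles in comparability graphs *)

Section OddCycles.

Variables (V : finType) (e o : rel V).
Hypotheses (orient_o : orientation e o) (trans_o : transitive o).

Let arcE x y : e x y = o x y || o y x. Proof. exact: orient_o.1. Qed.

Lemma opposite_arc x y : e x y -> o y x = ~~ o x y.
Proof. by rewrite arcE; move: (orient_o.2 x y); do 2!case: (o _ _). Qed.

(** Gallai's forcing: arcs passing through y in one direction would compose to an
    arc between the nonadjacent x and w. *)
Lemma forced_arc x y w : e x y -> e y w -> ~~ e x w -> o x y = o w y.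
Proof.
move=> exy eyw; rewrite arcE => /norP[nxw nwx].
apply/idP/idP => [oxy|owy]; apply: contraT.
  by rewrite (opposite_arc eyw) negbK => oyw; rewrite (trans_o oxy oyw) in nxw.
by rewrite -(opposite_arc exy) => oyx; rewrite (trans_o owy oyx) in nwx.
Qed.

(** The cycle v_0 ... v_l has l.+1 vertices, so this says that it is even.  The
    directions of its edges alternate, and going once around must be consistent.
    For l = 2 the cycle is a triangle and nothing is forced. *)
Lemma induced_cycle_odd (v : nat -> V) l :
  2 < l ->
  (forall j j', j < j' <= l ->
     e (v j) (v j') = (j' == j.+1) || ((j == 0) && (j' == l))) ->
  odd l.
Proof.
move=> l_gt2 cycle_v.
have esym x y : e x y = e y x by rewrite !arcE orbC.
have alternating j : j < l -> o (v j) (v j.+1) = odd j (+) o (v 0) (v 1).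
  elim: j => // j IHj lt_jl.
  have ej : e (v j) (v j.+1) by rewrite cycle_v; lia.
  have ej1 : e (v j.+1) (v j.+2) by rewrite cycle_v; lia.
  have nej : ~~ e (v j) (v j.+2) by rewrite cycle_v; lia.
  rewrite -[LHS]negbK -(opposite_arc ej1) -(forced_arc ej ej1 nej) IHj;
    last by lia.
  by rewrite /= addNb.
have e01 : e (v 0) (v 1) by rewrite cycle_v; lia.
have e0l : e (v 0) (v l) by rewrite cycle_v; lia.
have el : e (v l.-1) (v l) by rewrite cycle_v; lia.
have forced0 : o (v 1) (v 0) = o (v l) (v 0).
  by apply: (forced_arc _ e0l); [rewrite esym | rewrite cycle_v; lia].
have forcedl : o (v 0) (v l) = o (v l.-1) (v l).
  by apply: (forced_arc e0l); [rewrite esym | rewrite cycle_v; lia].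
have := alternating l.-1; rewrite prednK; last lia.
rewrite -forcedl.
move: forced0; rewrite (opposite_arc e01) (opposite_arc e0l) => /negb_inj ->.
case: (o _ _); rewrite ?addbT ?addbF; lia.
Qed.

End OddCycles.

(** * The order on a melon and its realizer *)

(** On a path the even positions are below. [upward] and [downward] give the ranks of the positions in the orders
    2 1 4 3 ... and ... 4 5 2 3 1 of the inner vertices. *)
Definition fence j j' := ~~ odd j && ((j' == j.+1) || (j == j'.+1)).
Definition upward j := if odd j then j.+1 else j.-1.
Definition downward l j := l - (if odd j then j.-1 else j.+1).

Lemma fence_upward j j' : fence j j' -> 0 < j -> upward j < upward j'.
Proof. by rewrite /fence /upward; do 2!case: ifP; lia. Qed.

Lemma fence_downward l j j' :
  fence j j' -> j < l -> downward l j < downward l j'.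
Proof. by rewrite /fence /downward; do 2!case: ifP; lia. Qed.

(** With the two lemmas above: the two orders realize the inner fence. *)
Lemma not_fence_upward_downward l j j' :
  0 < j < l -> 0 < j' < l -> odd l -> j <> j' -> ~~ fence j' j ->
  (upward j < upward j') || (downward l j < downward l j').
Proof. by rewrite /fence /upward /downward; do 2!case: ifP; lia. Qed.

(** The place of a vertex in the melon: z, z', the middle vertex of the i-th path
    when it has length 2, or the j-th vertex of the i-th path otherwise. *)
Inductive site := Bottom | Top | Middle of nat | Inner of nat & nat.

Section Sites.

Variables (m : nat) (len : nat -> nat).
Implicit Types s t : site.

Definition proper_site s : bool :=
  match s with
  | Middle i => i < m
  | Inner i j => [&& i < m, 0 < j < len i & odd (len i)]
  | _ => true
  end.

Definition below s t : bool :=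
  match s, t with
  | Bottom, Top => true
  | Bottom, Middle _ => true
  | Middle _, Top => true
  | Bottom, Inner _ j => j == 1
  | Inner i j, Top => j.+1 == len i
  | Inner i j, Inner i' j' => (i == i') && fence j j'
  | _, _ => false
  end.

(** A key consists of the number of a block, the rank of the path in this block,
    which is i or m - i, and the rank of the vertex in its path. *)
Local Notation key := (nat *l (nat *l nat))%type.

Definition first_key s : key :=
  match s with
  | Bottom => (0, (0, 0))
  | Middle i => (2, (i, 0))
  | Top => (5, (0, 0))
  | Inner i j =>
      if len i == 3 then (3, (m - i, upward j))
      else if j.+2 < len i then (1, (i, upward j))
      else (4, (m - i, upward j))
  end.

Definition second_key s : key :=
  match s with
  | Bottom => (1, (0, 0))
  | Middle i => (3, (i, 0))
  | Top => (5, (0, 0))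
  | Inner i j =>
      if len i == 3 then (2, (i, upward j))
      else if j == 1 then (4, (i, 0))
      else (0, (i, downward (len i) j))
  end.

Definition third_key s : key :=
  match s with
  | Bottom => (2, (0, 0))
  | Middle i => (3, (m - i, 0))
  | Top => (4, (0, 0))
  | Inner i j =>
      if len i == 3 then (if j == 2 then (0, (i, 0)) else (5, (i, 0)))
      else if j.+1 == len i then (1, (m - i, 0))
      else (6, (m - i, downward (len i) j))
  end.

Lemma key_ltE a b c a' b' c' :
  (((a, (b, c)) : key) < (a', (b', c')))%O =
    (a < a') || (a == a') && ((b < b') || (b == b') && (c < c')).
Proof. by rewrite !ltEprodlexi /=; lia. Qed.

(** Inside one path the distribution over blocks does not disturb the orders up
    and down: for long fences the blocks of the first order cut up into an initial
    and a final part, and those of the other orders cut off the last or the first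
    vertex of down.  For a short fence all the orders agree. *)
Lemma keys_on_path i j j' :
  0 < j < len i -> 0 < j' < len i -> odd (len i) ->
  (upward j < upward j' ->
     (first_key (Inner i j) < first_key (Inner i j'))%O) /\
  (downward (len i) j < downward (len i) j' ->
     (second_key (Inner i j) < second_key (Inner i j'))%O /\
     (third_key (Inner i j) < third_key (Inner i j'))%O).
Proof.
rewrite /first_key /second_key /third_key.
move: (len i) => l j_in j'_in odd_l; split.
  case: eqP => [_|l_ne3]; first by rewrite key_ltE; lia.
  rewrite {1 2}/upward; do 2!case: ifP; do 2!case: ifP;
    by rewrite !key_ltE /upward; do 2!case: ifP; lia.
move=> lt_down; case: eqP => [l3|l_ne3].
  have [-> ->] : j = 2 /\ j' = 1.
    by move: lt_down; rewrite /downward; do 2!case: ifP; lia.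
  by rewrite !key_ltE !eqxx !orbT.
split; move: lt_down; do 2!case: ifP;
  by rewrite !key_ltE /downward; do 2!case: ifP; lia.
Qed.

Lemma below_keys s t :
  proper_site s -> proper_site t -> below s t ->
  [&& (first_key s < first_key t)%O, (second_key s < second_key t)%O
    & (third_key s < third_key t)%O].
Proof.
case: s t => [||i|i j] [||i'|i' j'] //=; rewrite ?key_ltE //.
1,2: by repeat case: ifP; rewrite ?key_ltE; lia.
move=> /and3P[_ j_in odd_l] /and3P[_ j'_in _] /andP[/eqP eq_i fence_jj'].
rewrite -eq_i in j'_in *.
have [up_lt down_lt] := keys_on_path j_in j'_in odd_l.
have [j_gt0 j_lt] := andP j_in.
have /up_lt := fence_upward fence_jj' j_gt0.
have /down_lt := fence_downward fence_jj' j_lt.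
by move=> /= [-> ->] ->.
Qed.

(** By symmetry both orders of an incomparable pair occur among the keys. *)
Lemma incomparable_keys s t :
  proper_site s -> proper_site t -> s <> t -> ~~ below s t -> ~~ below t s ->
  [|| (first_key s < first_key t)%O, (second_key s < second_key t)%O
    | (third_key s < third_key t)%O].
Proof.
case: s t => [||i|i j] [||i'|i' j'] //=; rewrite ?key_ltE //;
  try by repeat case: ifP; rewrite ?key_ltE; lia.
  move=> i_lt i'_lt ne_st _ _; have ne_i : i <> i' by congruence.
  by lia.
move=> /and3P[i_lt j_in odd_l] /and3P[i'_lt j'_in odd_l'] ne_st.
have [eq_i _|ne_i _ _] /= := eqVneq i i'.
  rewrite -eq_i in ne_st j'_in *; rewrite /= => not_fence.
  have ne_j : j <> j' by congruence.
  have [up_lt down_lt] := keys_on_path j_in j'_in odd_l.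
  case/orP: (not_fence_upward_downward j_in j'_in odd_l ne_j not_fence).
    by move/up_lt => /= ->.
  by case/down_lt => /= ->; rewrite orbT.
by do 2![case: ifP => ?]; repeat case: ifP; rewrite ?key_ltE /=; lia.
Qed.

End Sites.

(** * Edges of a path in terms of positions *)

Section Paths.
Variable V : finType.
Implicit Types (x y : V) (s : seq V).

Lemma infix_pair_index s x y :
  uniq s -> y \in s -> infix [:: x; y] s = (index y s == (index x s).+1).
Proof.
move=> uniq_s y_s; apply/infixP/eqP => [[s1 [s2 s_eq]]|y_next].
  move: uniq_s; rewrite s_eq cat_uniq /= inE !negb_or -!andbA.
  case/and5P=> _ x's1 y's1 _ /andP[ne_xy _].
  rewrite !index_cat (negPf x's1) (negPf y's1) /= eqxx (negPf ne_xy) eqxx.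
  by rewrite addn0 addn1.
have lt_y : (index x s).+1 < size s by rewrite -y_next index_mem.
exists (take (index x s) s), (drop (index x s).+2 s).
rewrite -[LHS](cat_take_drop (index x s)) (drop_nth x) 1?ltnW //.
rewrite (drop_nth x) // -[in nth x s _.+1]y_next !nth_index //.
by rewrite -index_mem ltnW.
Qed.

Lemma path_edge_index s x y :
  uniq s -> x \in s -> y \in s ->
  path_edge s x y =
    (index y s == (index x s).+1) || (index x s == (index y s).+1).
Proof. by move=> uniq_s x_s y_s; rewrite /path_edge !infix_pair_index. Qed.

Lemma path_edge_mem s x y : path_edge s x y -> (x \in s) && (y \in s).
Proof.
by case/orP=> /infixP[s1 [s2 ->]]; rewrite !mem_cat !inE !eqxx ?orbT.
Qed.

End Paths.

(** * Melon graphs *)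

Section Melon.

Variables (V : finType) (e : rel V) (z z' : V) (m : nat) (E : 'I_m -> seq V).
Hypothesis path_E : forall i, path_from_to z z' (E i).

Definition path_length (i : 'I_m) := (size (E i)).-1.
Definition internal x := (x != z) && (x != z').

Variable path_of : V -> 'I_m.
Hypothesis path_ofP : forall x, x \in E (path_of x).

Lemma ends_neq : z != z'.
Proof.
have [uniq_s [p s_eq]] := path_E (path_of z).
by move: uniq_s; rewrite s_eq /= mem_rcons inE negb_or => /andP[/andP[]].
Qed.

Lemma size_path i : size (E i) = (path_length i).+1.
Proof. by rewrite /path_length; have [_ [p ->]] := path_E i. Qed.

Lemma start_in_path i : (z \in E i) * (index z (E i) = 0).
Proof. by have [_ [p ->]] := path_E i; rewrite inE /= !eqxx. Qed.

Lemma finish_in_path i : (z' \in E i) * (index z' (E i) = path_length i).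
Proof.
rewrite /path_length; have [uniq_E [p E_eq]] := path_E i.
rewrite E_eq /= in uniq_E *; rewrite inE mem_rcons mem_head orbT.
rewrite (negPf ends_neq) -cats1 index_cat size_cat /= addn1.
move: uniq_E; rewrite rcons_uniq => /and3P[_ /negPf -> _].
by rewrite /= eqxx addn0.
Qed.

Lemma internal_index i x :
  x \in E i -> internal x -> 0 < index x (E i) < path_length i.
Proof.
move=> x_i /andP[ne_xz ne_xz'].
have [z_i z_0] := start_in_path i; have [z'_i z'_l] := finish_in_path i.
have lt_x : index x (E i) < (path_length i).+1 by rewrite -size_path index_mem.
have ne0 : index x (E i) != 0.
  apply: contraNneq ne_xz => x0.
  by apply/eqP/(index_inj x x_i z_i); rewrite x0.
have nel : index x (E i) != path_length i.
  apply: contraNneq ne_xz' => xl.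
  by apply/eqP/(index_inj x x_i z'_i); rewrite xl.
lia.
Qed.

(** Sites carry plain numbers instead of ordinals, as their keys compute with
    them. *)
Definition nat_length (n : nat) := oapp path_length 0 (insub n).

Lemma nat_lengthE (i : 'I_m) : nat_length i = path_length i.
Proof. by rewrite /nat_length valK. Qed.

Definition site_of x : site :=
  if x == z then Bottom else if x == z' then Top else
  if path_length (path_of x) == 2 then Middle (path_of x)
  else Inner (path_of x) (index x (E (path_of x))).

Variant site_spec x : site -> Prop :=
| SiteBottom of x = z : site_spec x Bottom
| SiteTop of x = z' : site_spec x Top
| SiteMiddle of internal x & path_length (path_of x) = 2
      & index x (E (path_of x)) = 1
    : site_spec x (Middle (path_of x))
| SiteInner of internal x & path_length (path_of x) != 2
      & 0 < index x (E (path_of x)) < path_length (path_of x)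
    : site_spec x (Inner (path_of x) (index x (E (path_of x)))).

Lemma site_ofP x : site_spec x (site_of x).
Proof.
rewrite /site_of; case: eqVneq => [->|ne_xz]; first exact: SiteBottom.
case: eqVneq => [->|ne_xz']; first exact: SiteTop.
have int_x : internal x by apply/andP.
have idx := internal_index (path_ofP x) int_x.
case: eqP => [len2|/eqP ne2]; last exact: SiteInner.
by apply: SiteMiddle => //; rewrite len2 in idx; lia.
Qed.

Lemma site_of_inj x y : site_of x = site_of y -> x = y.
Proof.
have same i j : i = j -> x \in E i -> y \in E j ->
    index x (E i) = index y (E j) -> x = y.
  by move=> -> x_j y_j /(index_inj x x_j y_j).
case: site_ofP => [->|->|int_x len_x idx_x|int_x len_x idx_x];
  case: site_ofP => [->|->|int_y len_y idx_y|int_y len_y idx_y] //.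
  by case=> /val_inj pxy; apply: (same _ _ pxy); rewrite ?path_ofP // idx_x.
by case=> /val_inj pxy; apply: (same _ _ pxy); rewrite ?path_ofP.
Qed.

Hypothesis disjoint_E : forall i j, i != j ->
  forall x, x \in E i -> x \in E j -> x = z \/ x = z'.

Lemma internal_path_unique i j x :
  internal x -> x \in E i -> x \in E j -> i = j.
Proof.
move=> /andP[ne_xz ne_xz'] x_i x_j; apply/eqP; apply: contraT => ne_ij.
have [xz|xz'] := disjoint_E ne_ij x_i x_j; first by rewrite xz eqxx in ne_xz.
by rewrite xz' eqxx in ne_xz'.
Qed.

Hypothesis edge_E : forall x y, e x y <-> exists i, path_edge (E i) x y.

Lemma melon_sym x y : e x y = e y x.
Proof.
apply/idP/idP => /edge_E[i exy]; apply/edge_E; exists i.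
  by rewrite /path_edge orbC.
by rewrite /path_edge orbC.
Qed.

Lemma melon_irrefl x : ~~ e x x.
Proof.
apply/negP => /edge_E[i exx]; have [uniq_E _] := path_E i.
have /andP[x_i _] := path_edge_mem exx.
by move: exx; rewrite path_edge_index //; lia.
Qed.

(** An internal vertex lies on a single path, so all its edges lie there too. *)
Lemma edge_on_path i x y :
  internal x -> x \in E i -> y \in E i ->
  e x y = (index y (E i) == (index x (E i)).+1)
          || (index x (E i) == (index y (E i)).+1).
Proof.
move=> int_x x_i y_i; have [uniq_E _] := path_E i.
rewrite -path_edge_index //; apply/idP/idP => [/edge_E[j exy]|exy].
  have /andP[x_j _] := path_edge_mem exy.
  by rewrite (internal_path_unique int_x x_i x_j).
by apply/edge_E; exists i.
Qed.

Lemma edge_same_path i j x y :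
  internal x -> internal y -> x \in E i -> y \in E j -> e x y -> i = j.
Proof.
move=> int_x int_y x_i y_j /edge_E[h exy].
have /andP[x_h y_h] := path_edge_mem exy.
rewrite (internal_path_unique int_x x_i x_h).
by rewrite (internal_path_unique int_y y_j y_h).
Qed.

Hypothesis edge_zz' : e z z'.

(** Together with the edge z z' the path is an induced cycle. *)
Lemma path_length_odd i :
  comparability_graph e -> 2 < path_length i -> odd (path_length i).
Proof.
move=> [o [orient_o trans_o]] len_gt2; have [uniq_E _] := path_E i.
apply: (induced_cycle_odd orient_o trans_o (v := nth z (E i)) len_gt2).
move=> j j' /andP[lt_jj' le_j'l].
have nthE j0 : j0 <= path_length i -> (nth z (E i) j0 \in E i)
    * (index (nth z (E i) j0) (E i) = j0).
  move=> le_j0; have lt_j0 : j0 < size (E i) by rewrite size_path.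
  by rewrite mem_nth // index_uniq.
have int j0 : 0 < j0 < path_length i -> internal (nth z (E i) j0).
  move=> hj0; have [_ idx] := nthE j0 ltac:(lia).
  apply/andP; split; apply/eqP => eq_v; move: hj0; rewrite -idx eq_v.
    by rewrite start_in_path.
  by rewrite finish_in_path ltnn andbF.
have [j_i idx_j] := nthE j ltac:(lia); have [j'_i idx_j'] := nthE j' ltac:(lia).
have [j0|j_gt0] := posnP j.
  have [j'l|ne_j'l] := eqVneq j' (path_length i).
    have -> : nth z (E i) j = z by have [_ [p ->]] := path_E i; rewrite j0.
    have -> : nth z (E i) j' = z'.
      by rewrite j'l -(finish_in_path i).2 nth_index // finish_in_path.
    by rewrite edge_zz' orbT.
  rewrite melon_sym (@edge_on_path i) ?int ?idx_j ?idx_j' //; lia.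
rewrite (@edge_on_path i) ?int ?idx_j ?idx_j' //; lia.
Qed.

Lemma site_of_proper x :
  comparability_graph e -> proper_site m nat_length (site_of x).
Proof.
move=> comp_e; case: site_ofP => //= int_x ne2 idx.
rewrite nat_lengthE ltn_ord idx path_length_odd //; lia.
Qed.

(** The parities built into [below] cost no edges: of two consecutive positions
    exactly one is even. *)
Lemma edge_below x y :
  e x y = below nat_length (site_of x) (site_of y)
       || below nat_length (site_of y) (site_of x).
Proof.
have to_start w : internal w -> e w z = (index w (E (path_of w)) == 1).
  move=> int_w; have z_i := start_in_path (path_of w).
  by rewrite (edge_on_path int_w (path_ofP w)) z_i.
have to_finish w : internal w ->
    e w z' = ((index w (E (path_of w))).+1 == path_length (path_of w)).
  move=> int_w; have z_i := finish_in_path (path_of w).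
  have := internal_index (path_ofP w) int_w.
  by rewrite (edge_on_path int_w (path_ofP w)) z_i //; lia.
have other w w' : path_of w != path_of w' -> internal w -> internal w' ->
    e w w' = false.
  move=> ne int_w int_w'; apply: contraNF ne => eww'.
  by apply/eqP; apply: edge_same_path eww'.
case: (site_ofP x) => [->|->|int_x len_x idx_x|int_x len_x idx_x];
  case: (site_ofP y) => [->|->|int_y len_y idx_y|int_y len_y idx_y];
  rewrite /= ?nat_lengthE ?orbF //;
  do ?[exact: negPf (melon_irrefl _)];
  rewrite ?(melon_sym z) ?(melon_sym z') ?edge_zz' ?to_start ?to_finish //;
  rewrite ?len_x ?len_y ?idx_x ?idx_y //.
- have [pxy|/other->//] := eqVneq (path_of x) (path_of y).
  have y_x : y \in E (path_of x) by rewrite pxy path_ofP.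
  by rewrite (edge_on_path int_x (path_ofP x) y_x) idx_x pxy idx_y.
- by apply: other => //; apply: contraNneq len_y => <-; apply/eqP.
- by apply: other => //; apply: contraNneq len_x => ->; apply/eqP.
have [pxy|ne_p] := eqVneq (path_of x) (path_of y); last first.
  by rewrite other // [_ == _](negPf ne_p) eq_sym [_ == _](negPf ne_p).
have y_x : y \in E (path_of x) by rewrite pxy path_ofP.
rewrite (edge_on_path int_x (path_ofP x) y_x) -pxy !eqxx /fence; lia.
Qed.

End Melon.

Theorem theorem7 (V : finType) (e : rel V) (z z' : V) :
  simple_graph e ->
  melon_graph e z z' ->
  comparability_graph e ->
  e z z' ->
  exists k : nat, is_perm_rep_number e k /\ (k <= 3)%N.
Proof.
move=> _ [m [E [_ path_E disjoint_E _ [cover_E edge_E]]]] comp_e edge_zz'.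
apply: perm_rep_number_le.
have [path_of path_ofP] := fin_all_exists cover_E.
pose st := site_of z z' E path_of; pose len := nat_length E.
have st_proper x : proper_site m len (st x).
  exact: (site_of_proper path_E path_ofP disjoint_E edge_E edge_zz').
have edge_st x y : e x y = below len (st x) (st y) || below len (st y) (st x).
  exact: edge_below.
pose keys := [:: first_key m len; second_key len; third_key m len].
pose key (c : 'I_3) x := nth (first_key m len) keys c (st x).
apply: (realizer_representable (key := key) _ edge_st) => // [x y|x y ne_xy].
  move/(below_keys (st_proper x) (st_proper y)) => /and3P[lt1 lt2 lt3].
  by case=> [[|[|[]]]].
have ne_st : st x <> st y.
  by move=> eq_st; rewrite (site_of_inj path_E path_ofP eq_st) eqxx in ne_xy.
move=> nxy nyx.
case/or3P: (incomparable_keys (st_proper x) (st_proper y) ne_st nxy nyx) => lt.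
- by exists ord0.
- by exists (Ordinal (isT : 1 < 3)).
- by exists ord_max.
Qed.
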